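(* Let $q\geq 4$ be a prime power and let $e$ be a positive divisor of $q-1$. If $\mathrm{Rad}(e)=\mathrm{Rad}(q-1)$, set $s=0$ and $\delta=1$. Otherwise, let $p_1,\ldots,p_s$ ($s\geq 1$) be the primes dividing $q-1$ but not dividing $e$, and set $\delta=1-2\sum_{i=1}^{s}p_i^{-1}$. Suppose that $\delta>0$ and that $$q>\left(\frac{2s-1}{\delta}+2\right)^2 W(e)^4 .$$ Then $q\in\mathcal{G}$, i.e. for all non-zero $a,c\in\mathbb{F}_q$ there exists a primitive root $g$ of $\mathbb{F}_q$ such that $a-cg$ is also a primitive root of $\mathbb{F}_q$.
   Context: For a positive integer $n$, $\mathrm{Rad}(n)$ denotes the product of the distinct prime factors of $n$, $\omega(n)$ the number of distinct prime factors of $n$, and $W(n)=2^{\omega(n)}$ the number of square-free divisors of $n$. $\mathcal{G}$ is the set of prime powers $q$ such that for all non-zero $a,c\in\mathbb{F}_q$ there is a primitive root $g\in\mathbb{F}_q$ (a generator of $\mathbb{F}_q^{*}$) with $a-cg$ also a primitive root. *)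

(* Defs.v *)
From mathcomp Require Import all_boot all_order all_algebra all_fingroup.
From mathcomp Require Import all_solvable all_field.

Set Implicit Arguments.
Unset Strict Implicit.
Unset Printing Implicit Defensive.

Import Order.TTheory GRing.Theory Num.Theory.
Local Open Scope ring_scope.

Definition Rad (n : nat) : nat := (\prod_(p <- primes n) p)%N.

Definition omega (n : nat) : nat := size (primes n).

Definition W (n : nat) : nat := (2 ^ omega n)%N.

Definition prime_power (q : nat) : Prop :=
  exists p k : nat, [/\ prime p, (0 < k)%N & q = (p ^ k)%N].

Definition primitive_root (F : finFieldType) (g : F) : Prop :=
  exists2 u : {unit F}, generator [set: {unit F}] u & FinRing.uval u = g.

(* F_q is unique up to isomorphism, so a property of F_q is stated for every
   finite field of cardinality q. *)
Definition in_G (q : nat) : Prop :=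
  prime_power q /\
  forall F : finFieldType, #|F| = q ->
  forall a c : F, a != 0 -> c != 0 ->
  exists g : F, primitive_root g /\ primitive_root (a - c * g).

Definition sieving_primes (q e : nat) : seq nat :=
  [seq p <- primes q.-1 | ~~ (p %| e)%N].

Definition sieve_s (q e : nat) : nat :=
  if Rad e == Rad q.-1 then 0%N else size (sieving_primes q e).

Definition sieve_delta (q e : nat) : rat :=
  if Rad e == Rad q.-1 then 1
  else 1 - 2%:R * \sum_(p <- sieving_primes q e) (p%:R)^-1.

(* Main.v *)
Require Import Defs.
From mathcomp Require Import all_boot all_order all_algebra all_fingroup.
From mathcomp Require Import all_solvable all_field.
From mathcomp Require Import ring.

Set Implicit Arguments.
Unset Strict Implicit.
Unset Printing Implicit Defensive.

Import Order.TTheory GRing.Theory Num.Theory.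
Local Open Scope ring_scope.

(** Let [t] be the square root of the field order [q]. If [s] is a list of
    primes dividing [q - 1], the indicator of the non-zero elements that are
    not [p]-th powers for any [p] in [s] is [theta s] times the trivial
    character plus a combination of non-trivial characters with coefficients
    of total modulus [2 ^ size s - 1]. The Jacobi sums of non-trivial
    characters have modulus at most [t], so the pairs [(x, a - c x)] that are
    free of the primes of [e] are counted with a controlled error; a union
    bound then removes the pairs in which one entry is a [p]-th power for one
    of the remaining primes [p] of [q - 1]. *)

Section MultiplicativeCharacters.

Variable F : finFieldType.
Implicit Types (x y a c : F) (chi psi : F -> algC) (m p : nat).

(** * Multiplicative characters and their complete sums *)

Definition mchar chi :=
  [/\ chi 0 = 0, chi 1 = 1 & {morph chi : x y / x * y}].

Definition nontrivial chi := exists2 x, x != 0 & chi x != 1.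

Lemma card_field_pred_gt0 : (0 < #|F|.-1)%N.
Proof. by rewrite -card_finField_unit cardG_gt0. Qed.

Lemma expf_card_pred x : x != 0 -> x ^+ #|F|.-1 = 1.
Proof.
move=> x0; apply: (mulfI x0); rewrite mulr1 -exprS prednK ?expf_card //.
by apply/card_gt0P; exists 0.
Qed.

Lemma mcharX chi x k : mchar chi -> chi (x ^+ k) = chi x ^+ k.
Proof.
by move=> [_ c1 cM]; elim: k => [|k IH]; rewrite ?expr0 // !exprS cM IH.
Qed.

Lemma mchar_norm chi x : mchar chi -> x != 0 -> `|chi x| = 1.
Proof.
move=> mc x0; have [_ c1 _] := mc.
apply/eqP; rewrite -(pexpr_eq1 card_field_pred_gt0) // -normrX -mcharX // expf_card_pred //.
by rewrite c1 normr1.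
Qed.

Lemma mchar_conj chi x : mchar chi -> (chi x)^* = chi x^-1.
Proof.
move=> mc; have [c0 c1 cM] := mc.
have [->|x0] := eqVneq x 0; first by rewrite invr0 c0 conjC0.
have cx0 : chi x != 0 by rewrite -normr_eq0 mchar_norm // oner_eq0.
by apply: (mulfI cx0); rewrite -normCK mchar_norm // -cM divff // c1 expr1n.
Qed.

Lemma mcharM chi psi :
  mchar chi -> mchar psi -> mchar (fun x => chi x * psi x).
Proof.
move=> [c0 c1 cM] [d0 d1 dM]; split; rewrite ?c0 ?mul0r ?c1 ?d1 ?mulr1 //.
by move=> x y; rewrite cM dM mulrACA.
Qed.

Lemma sum_nontrivial chi : mchar chi -> nontrivial chi -> \sum_(x : F) chi x = 0.
Proof.
move=> [_ _ cM] [y y0 cy1].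
have : (chi y - 1) * \sum_(x : F) chi x == 0.
  rewrite mulrBl mul1r mulr_sumr [X in _ - X](reindex_inj (mulfI y0)) subr_eq0.
  by apply/eqP/eq_bigr => x _; rewrite cM.
by rewrite mulf_eq0 subr_eq0 (negPf cy1) => /eqP.
Qed.

Lemma sum_mchar_ge0 chi : mchar chi -> 0 <= \sum_(x : F) chi x.
Proof.
move=> mc; have [|] := boolP [exists x, (x != 0) && (chi x != 1)].
  by case/existsP=> x /andP[x0 cx]; rewrite sum_nontrivial //; exists x.
move/existsPn=> triv; apply: sumr_ge0 => x _.
have [->|x0] := eqVneq x 0; first by case: mc => ->.
by have := triv x; rewrite x0 /= negbK => /eqP->.
Qed.

Lemma sum_affine_nontrivial psi a c : mchar psi -> nontrivial psi ->
  c != 0 -> \sum_(x : F) psi (a - c * x) = 0.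
Proof.
move=> mp np c0; rewrite -[RHS](sum_nontrivial mp np).
rewrite [RHS](reindex_inj (h := fun x => a - c * x)) // => x y.
by move/(addrI a)/oppr_inj/(mulfI c0).
Qed.

(** * Jacobi sums *)

(** For [u != 1] the affine map [(1 - u) z + u] permutes [F], so the full sum vanishes, and the
    omitted points 0 and 1 account for [psi u] and 1. For [u = 1] every term is 1. *)
Lemma sum_moebius psi u : mchar psi -> nontrivial psi ->
  \sum_(z : F | (z != 0) && (z != 1)) psi ((1 - u) * z + u) =
    if u == 1 then #|F|%:R - 2%:R else - psi u - 1.
Proof.
move=> mp np; have [_ p1 _] := mp.
have [->|u1] := eqVneq u 1.
  rewrite (eq_bigr (fun=> 1)) => [|z _]; last by rewrite subrr mul0r add0r p1.
  have <- : \sum_(z : F) 1 = #|F|%:R :> algC by rewrite sumr_const.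
  rewrite [X in X - _](bigD1 0) //= [X in _ + X - _](bigD1 1) ?oner_eq0 //=.
  ring.
have := sum_affine_nontrivial u mp np (_ : u - 1 != 0); rewrite subr_eq0.
move=> /(_ u1); rewrite (bigD1 0) //= (bigD1 1) ?oner_eq0 //=.
have -> : u - (u - 1) * 1 = 1 by ring.
rewrite mulr0 subr0 p1 => eS.
rewrite (eq_bigr (fun z => psi (u - (u - 1) * z))); last first.
  by move=> z _; congr psi; ring.
apply: (addrI (psi u + 1)); rewrite -addrA eS; ring.
Qed.

(* In the double sum for the squared norm, put [x = u y] and then
   [y = 1 - 1 / z]; this turns [(1 - x) / (1 - y)] into [(1 - u) z + u]. *)
Lemma Jacobi_sum_sqnorm chi psi : mchar chi -> mchar psi ->
  nontrivial chi -> nontrivial psi ->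
  `|\sum_(x : F) chi x * psi (1 - x)| ^+ 2 = #|F|%:R - \sum_(x : F) chi x * psi x.
Proof.
move=> mc mp nc np; have [c0 c1 cM] := mc; have [p0 p1 pM] := mp.
rewrite normCK rmorph_sum mulr_sumr.
transitivity (\sum_(y : F | y != 0) \sum_(u : F) chi u * psi ((1 - u * y) / (1 - y))).
  rewrite (bigD1 0) //= c0 mul0r rmorph0 mulr0 add0r.
  apply: eq_bigr => y y0; rewrite mulr_suml (reindex_inj (mulIf y0)) /=.
  apply: eq_bigr => u _; rewrite rmorphM /= !mchar_conj // cM pM.
  have cyV : chi y * chi y^-1 = 1 by rewrite -cM divff.
  by rewrite mulrACA -[chi u * _ * _]mulrA cyV mulr1.
have hinj : injective (fun z : F => 1 - z^-1).
  by move=> z t /(addrI 1)/oppr_inj/invr_inj.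
rewrite (reindex_inj hinj) /= exchange_big /=.
transitivity (\sum_(u : F) chi u *
  \sum_(z : F | (z != 0) && (z != 1)) psi ((1 - u) * z + u)).
  apply: eq_bigr => u _; rewrite mulr_sumr big_mkcond [RHS]big_mkcond /=.
  (* Since [0^-1 = 0], the point [z = 0] corresponds to [y = 1], where the quotient by [1 - y] is 0
     and [psi] vanishes. The point [z = 1] is the excluded [y = 0]. *)
  apply: eq_bigr => z _; have [->|z0] := eqVneq z 0.
    by rewrite invr0 !subr0 subrr invr0 mulr0 p0 mulr0 oner_eq0.
  rewrite subr_eq0 eq_sym -[1]invr1 (inj_eq invr_inj) invr1 /=.
  case: ifP => // _; congr (_ * psi _); rewrite opprB addrCA subrr addr0 invrK.
  by field.
rewrite (eq_bigr _ (fun u _ => congr1 _ (sum_moebius u mp np))).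
rewrite (bigD1 1) //= eqxx c1 mul1r.
rewrite [\sum_x _](bigD1 1) //= c1 p1 mul1r.
rewrite (eq_bigr (fun u => - (chi u * psi u) - chi u)); last first.
  by move=> u /negPf->; ring.
have := sum_nontrivial mc nc; rewrite (bigD1 1) //= c1 => /eqP.
rewrite addrC addr_eq0 => /eqP eS.
by rewrite sumrB sumrN eS -[2%:R]/(1 + 1); ring.
Qed.

Lemma Jacobi_sum_le chi psi : mchar chi -> mchar psi ->
  nontrivial chi -> nontrivial psi ->
  `|\sum_(x : F) chi x * psi (1 - x)| <= sqrtC #|F|%:R.
Proof.
move=> mc mp nc np; rewrite -(ler_pXn2r (n := 2)) ?nnegrE ?sqrtC_ge0 ?ler0n //.
by rewrite sqrtCK Jacobi_sum_sqnorm // gerBl (sum_mchar_ge0 (mcharM mc mp)).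
Qed.

(** Replacing [x] by [(a / c) x] takes out the factor [chi (a / c) * psi a], of modulus 1. *)
Lemma linear_Jacobi_sum_le chi psi a c : mchar chi -> mchar psi ->
  nontrivial chi -> nontrivial psi -> a != 0 -> c != 0 ->
  `|\sum_(x : F) chi x * psi (a - c * x)| <= sqrtC #|F|%:R.
Proof.
move=> mc mp nc np a0 c0; have [_ _ cM] := mc; have [_ _ pM] := mp.
have ac0 : a / c != 0 by rewrite mulf_neq0 ?invr_eq0.
suff -> : `|\sum_(x : F) chi x * psi (a - c * x)| = `|\sum_(x : F) chi x * psi (1 - x)|.
  exact: Jacobi_sum_le.
rewrite (reindex_inj (mulfI ac0)) /=.
transitivity `|chi (a / c) * psi a * \sum_(x : F) chi x * psi (1 - x)|; last first.
  by rewrite !normrM !mchar_norm // !mul1r.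
rewrite mulr_sumr; congr `|_|; apply: eq_bigr => x _.
by rewrite mulrACA -cM -pM mulrBr mulr1 [a / c * x]mulrAC mulrCA divff // mulr1.
Qed.

(** The sum over all [x] vanishes, so removing [x = 0] leaves [- psi a]. *)
Lemma trivial_Jacobi_sum_le psi a c : mchar psi -> nontrivial psi ->
  a != 0 -> c != 0 -> `|\sum_(x : F | x != 0) psi (a - c * x)| <= 1.
Proof.
move=> mp np a0 c0; have := sum_affine_nontrivial a mp np c0.
rewrite (bigD1 0) //= mulr0 subr0 => /eqP; rewrite addrC addr_eq0 => /eqP->.
by rewrite normrN mchar_norm.
Qed.

(** * Characters of prime order *)

Lemma exists_prim_root : exists z : F, #|F|.-1.-primitive_root z.
Proof.
suff /hasP[z _ pz] : has #|F|.-1.-primitive_root (enum (predC1 (0 : F))).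
  by exists z.
apply: has_prim_root; rewrite ?enum_uniq ?card_field_pred_gt0 //.
  apply/allP=> x; rewrite mem_enum => x0.
  by rewrite unity_rootE expf_card_pred.
by rewrite -cardE cardC1.
Qed.

Lemma eq1_coprime_expr (y : algC) j k :
  coprime j k -> y ^+ j = 1 -> y ^+ k = 1 -> y = 1.
Proof.
move=> cjk yj yk; have [j0|j0] := posnP j.
  by move: cjk; rewrite j0 /coprime gcd0n => /eqP k1; rewrite k1 in yk.
have [d prd dj] := prim_order_exists j0 yj.
have dk : (d %| k)%N by rewrite (prim_order_dvd prd) yk.
have : (d %| gcdn j k)%N by rewrite dvdn_gcd dj dk.
rewrite (eqP cjk) dvdn1 => /eqP d1.
by apply/eqP; rewrite -[y]expr1 -(prim_order_dvd prd) d1.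
Qed.

(** For [p] dividing [#|F|.-1], the last clause identifies the kernel of [chi] with the group of
    [p]-th powers, through Euler's criterion. *)
Definition order_char p chi :=
  [/\ mchar chi, nontrivial chi, forall x, x != 0 -> chi x ^+ p = 1
    & forall x, x != 0 -> (chi x == 1) = (x ^+ (#|F|.-1 %/ p) == 1)].

(** With [z] a generator and [zeta] a primitive [p]-th root of unity, [chi] sends [z ^+ i] to
    [zeta ^+ i]. This is well defined because exponents congruent modulo [#|F|.-1] are congruent
    modulo its divisor [p]. *)
Lemma exists_order_char p :
  prime p -> (p %| #|F|.-1)%N -> exists chi, order_char p chi.
Proof.
move=> pp pn; have p0 := prime_gt0 pp.
have [z pz] := exists_prim_root; have n0 := prim_order_gt0 pz.
have [zeta pzeta] := C_prim_root_exists p0.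
have z0 : z != 0.
  apply/eqP=> z0; have /eqP := prim_expr_order pz.
  by rewrite z0 expr0n gtn_eqF // eq_sym oner_eq0.
have logP x : x != 0 -> exists i : 'I_(#|F|.-1), x == z ^+ i.
  by move=> x0; have [i ->] := prim_rootP pz (expf_card_pred x0); exists i.
pose log x := if [pick i : 'I_(#|F|.-1) | x == z ^+ i] is Some i
  then val i else 0%N.
have logK x : x != 0 -> z ^+ log x = x.
  move=> /logP[i xi]; rewrite /log; case: pickP => [j /eqP <- //|/(_ i)].
  by rewrite xi.
have zetaE i j : z ^+ i = z ^+ j -> zeta ^+ i = zeta ^+ j.
  move=> /eqP; rewrite (eq_prim_root_expr pz) => eij; apply/eqP.
  rewrite (eq_prim_root_expr pzeta); move: eij.
  wlog lij : i j / (i <= j)%N => [H|].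
    case/orP: (leq_total i j) => [/H //|/H ji eij].
    by rewrite eq_sym; apply: ji; rewrite eq_sym.
  rewrite ![i == _ %[mod _]]eq_sym !eqn_mod_dvd //.
  exact: dvdn_trans.
pose chi x := if x == 0 then 0 else zeta ^+ log x.
have chiE i : chi (z ^+ i) = zeta ^+ i.
  rewrite /chi expf_eq0 (negPf z0) andbF; apply: zetaE.
  by rewrite logK // expf_neq0.
have chi0 x : x != 0 -> chi x = zeta ^+ log x by rewrite /chi => /negPf->.
have chi1P x : x != 0 -> (chi x == 1) = (x ^+ (#|F|.-1 %/ p) == 1).
  move=> x0; rewrite chi0 // -{2}(logK x x0) -exprM -(prim_order_dvd pz).
  rewrite -(prim_order_dvd pzeta) -{1}(divnK pn) mulnC dvdn_pmul2r //.
  by rewrite divn_gt0 // dvdn_leq.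
exists chi; split=> //.
- split; first by rewrite /chi eqxx.
    by rewrite -(expr0 z) chiE.
  move=> x y; have [->|x0] := eqVneq x 0; first by rewrite mul0r /chi eqxx mul0r.
  have [->|y0] := eqVneq y 0; first by rewrite mulr0 /chi eqxx mulr0.
  by rewrite -{1}(logK x x0) -{1}(logK y y0) -exprD chiE exprD -!chi0.
- exists z => //; rewrite -[z]expr1 chiE -(prim_order_dvd pzeta) dvdn1.
  by rewrite gtn_eqF // prime_gt1.
by move=> x x0; rewrite chi0 // exprAC (prim_expr_order pzeta) expr1n.
Qed.

(** * Combinations of non-trivial characters *)

Definition exponent_char m chi :=
  [/\ mchar chi, nontrivial chi & forall x, x != 0 -> chi x ^+ m = 1].

(* [span m w f]: [f] is a linear combination, with coefficients of total
   modulus [w], of non-trivial characters of exponent [m]. *)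
Inductive span m : algC -> (F -> algC) -> Prop :=
| span_char chi : exponent_char m chi -> span m 1 chi
| span0 : span m 0 (fun=> 0)
| spanD w v f g : span m w f -> span m v g ->
    span m (w + v) (fun x => f x + g x)
| spanZ b w f : span m w f -> span m (`|b| * w) (fun x => b * f x)
| span_ext w f g : f =1 g -> span m w f -> span m w g.

Lemma span_dvdn m m' w f : (m %| m')%N -> span m w f -> span m' w f.
Proof.
move=> /dvdnP[k ->]; elim=> {w f} [chi [mc nc ec]||||].
- by apply: span_char; split=> // x x0; rewrite mulnC exprM ec ?expr1n.
- exact: span0.
- by move=> *; apply: spanD.
- by move=> *; apply: spanZ.
by move=> w f g fg _; apply: span_ext.
Qed.

Lemma span_sum m (r : seq nat) (P : pred nat) (w : nat -> algC) f :
  (forall k, P k -> span m (w k) (f k)) ->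
  span m (\sum_(k <- r | P k) w k) (fun x => \sum_(k <- r | P k) f k x).
Proof.
move=> sf; elim: r => [|k r IH].
  by rewrite big_nil; apply: span_ext (span0 m) => x; rewrite big_nil.
have [Pk|Pk] := boolP (P k); last first.
  rewrite big_cons (negPf Pk); apply: span_ext IH => x.
  by rewrite big_cons (negPf Pk).
rewrite big_cons Pk; apply: span_ext (spanD (sf k Pk) IH) => x.
by rewrite big_cons Pk.
Qed.

(** If the product took the value 1 where [psi y != 1], its [m]-th power would give
    [psi y ^+ (k * m) = 1]; as [k * m] is coprime to [p], this forces [psi y = 1]. The character
    [chi] may be trivial, which is how [eps] is handled. *)
Lemma exponent_char_mul m p chi psi k : coprime m p -> prime p ->
  order_char p psi -> (0 < k < p)%N ->
  mchar chi -> (forall x, x != 0 -> chi x ^+ m = 1) ->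
  exponent_char (m * p) (fun x => chi x * psi x ^+ k).
Proof.
move=> cmp pp [mp [y y0 py] ep _] /andP[k0 kp] mc ec.
have [c0 c1 cM] := mc; have [p0 p1 pM] := mp.
have ckp : coprime k p by rewrite coprime_sym prime_coprime // gtnNdvd.
have mpk : mchar (fun x => psi x ^+ k).
  split; rewrite ?p0 ?expr0n ?p1 ?expr1n // ?gtn_eqF //.
  by move=> u v; rewrite pM exprMn.
split; first exact: mcharM.
  exists y => //; apply: contra py => /eqP e1; apply/eqP.
  apply: (@eq1_coprime_expr _ (k * m) p); rewrite ?coprimeMl ?ckp ?cmp ?ep //.
  by rewrite exprM -[LHS]mul1r -{1}(ec y y0) -exprMn e1 expr1n.
move=> x x0; rewrite exprMn exprM ec // expr1n mul1r -exprM mulnC.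
by rewrite [(m * p)%N]mulnC -mulnA exprM ep // expr1n.
Qed.

Lemma span_mul m p psi k w f : coprime m p -> prime p ->
  order_char p psi -> (0 < k < p)%N -> span m w f ->
  span (m * p) w (fun x => f x * psi x ^+ k).
Proof.
move=> cmp pp op kp; elim=> {w f}.
- by move=> chi [mc _ ec]; apply: span_char; apply: exponent_char_mul.
- by apply: span_ext (span0 _) => x; rewrite mul0r.
- by move=> w v f g _ sf _ sg; apply: span_ext (spanD sf sg) => x; rewrite mulrDl.
- by move=> b w f _ sf; apply: span_ext (spanZ b sf) => x; rewrite mulrA.
by move=> w f g fg _; apply: span_ext => x; rewrite fg.
Qed.

(** * Character expansions of the indicators of powers and of free elements *)

Definition eps x : algC := (x != 0)%:R.

Lemma mchar_eps : mchar eps.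
Proof.
rewrite /eps; split; rewrite ?eqxx ?oner_eq0 // => x y.
by rewrite mulf_eq0 negb_or -natrM mulnb.
Qed.

(** The normalisation gives the coefficients total modulus 1, so multiplying a combination by this
    average does not increase its weight. *)
Definition avg_char p psi x : algC :=
  (p.-1)%:R^-1 * \sum_(1 <= k < p) psi x ^+ k.

Lemma span_avg_char m p psi w f : coprime m p -> prime p ->
  order_char p psi -> span m w f ->
  span (m * p) (1 + w) (fun x => (eps x + f x) * avg_char p psi x).
Proof.
move=> cmp pp op sf; have p1 := prime_gt1 pp.
have q0 : (p.-1)%:R != 0 :> algC by rewrite pnatr_eq0 -lt0n -subn1 subn_gt0.
have term k : (0 < k < p)%N -> span (m * p) (`|(p.-1)%:R^-1| * (1 + w))
    (fun x => (p.-1)%:R^-1 * (eps x * psi x ^+ k + f x * psi x ^+ k)).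
  move=> kp; apply: spanZ; apply: spanD (span_mul cmp pp op kp sf).
  apply: span_char; apply: exponent_char_mul => //; first exact: mchar_eps.
  by move=> x x0; rewrite /eps x0 expr1n.
have := @span_sum (m * p) (index_iota 1 p) (fun k => 0 < k < p)%N _ _ term.
have -> : \sum_(k <- index_iota 1 p | (0 < k < p)%N)
            `|(p.-1)%:R^-1 : algC| * (1 + w) = 1 + w.
  rewrite big_seq_cond (eq_bigl (fun k => k \in index_iota 1 p)); last first.
    by move=> k; rewrite mem_index_iota andbb.
  rewrite -big_seq -mulr_suml sumr_const_nat subn1 normfV normr_nat.
  by rewrite -[_ *+ _]mulr_natl divff // mul1r.
apply: span_ext => x; rewrite /avg_char mulrCA mulr_sumr mulr_sumr.
rewrite big_seq_cond (eq_bigl (fun k => k \in index_iota 1 p)); last first.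
  by move=> k; rewrite mem_index_iota andbb.
by rewrite -big_seq; apply: eq_bigr => k _; rewrite mulrDl.
Qed.

(* For [p] dividing [#|F|.-1] and [x] non-zero: [x] is a [p]-th power. *)
Definition power p x := x ^+ (#|F|.-1 %/ p) == 1.

(** The mean of [psi x ^+ k] over [0 <= k < p] is 1 if [psi x = 1], and otherwise 0 by the geometric
    sum. The term [k = 0] supplies [p^-1]. *)
Lemma power_indicator p psi x : prime p -> order_char p psi -> x != 0 ->
  (power p x)%:R = p%:R^-1 + (1 - p%:R^-1) * avg_char p psi x.
Proof.
move=> pp [_ _ ep eqp] x0; have p1 := prime_gt1 pp.
have pn0 : p%:R != 0 :> algC by rewrite pnatr_eq0 -lt0n ltnW.
have q0 : (p.-1)%:R != 0 :> algC by rewrite pnatr_eq0 -lt0n -subn1 subn_gt0.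
have pE : p%:R = 1 + (p.-1)%:R :> algC by rewrite nat1r prednK // ltnW.
have -> : p%:R^-1 + (1 - p%:R^-1) * avg_char p psi x =
          p%:R^-1 * \sum_(0 <= k < p) psi x ^+ k.
  rewrite big_ltn ?(ltnW p1) // expr0 /avg_char pE; field.
  by rewrite -pE pn0 q0.
rewrite /power -eqp // big_mkord; have [->|px] := eqVneq (psi x) 1.
  under eq_bigr do rewrite expr1n.
  by rewrite sumr_const card_ord mulVf.
have := subrX1 (psi x) p; rewrite ep // subrr => /esym/eqP.
by rewrite mulf_eq0 subr_eq0 (negPf px) => /eqP->; rewrite mulr0.
Qed.

Definition free (s : seq nat) x := (x != 0) && all (fun p => ~~ power p x) s.

(** For distinct primes with product [m], this is Euler's ratio phi(m) / m. *)
Definition theta (s : seq nat) : algC := \prod_(p <- s) (1 - p%:R^-1).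

(** The main term is kept as a multiple of the indicator of [free s] instead of being expanded. In
    the sieve it then only rescales the count of free pairs, and the new error comes from [h']
    alone. *)
Lemma power_decomposition (s : seq nat) p m w h :
  coprime m p -> prime p -> (p %| #|F|.-1)%N -> span m w h ->
  (forall x, (free s x)%:R = theta s * (eps x + h x)) ->
  exists2 h', span (m * p) (1 + w) h' &
    forall x, (free s x && power p x)%:R =
      p%:R^-1 * (free s x)%:R + (1 - p%:R^-1) * theta s * h' x.
Proof.
move=> cmp pp pn sh free_h; have [psi op] := exists_order_char pp pn.
exists (fun x => (eps x + h x) * avg_char p psi x).
  exact: span_avg_char.
move=> x; rewrite -mulnb natrM; have [->|x0] := eqVneq x 0.
  have -> : avg_char p psi 0 = 0.
    rewrite /avg_char big_nat big1 ?mulr0 // => k /andP[k0 _].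
    by have [[-> _ _] _ _ _] := op; rewrite expr0n gtn_eqF.
  by rewrite /free eqxx !(mul0r, mulr0) addr0.
rewrite (power_indicator pp op x0) free_h; ring.
Qed.

Lemma coprime_prod_primes (s : seq nat) p : all prime s -> prime p ->
  p \notin s -> coprime (\prod_(r <- s) r)%N p.
Proof.
move=> ps pp; elim: s ps => [|r s IH] /=; first by rewrite big_nil coprime1n.
case/andP=> pr /IH{}IH; rewrite inE negb_or big_cons coprimeMl => /andP[npr /IH->].
by rewrite andbT prime_coprime // dvdn_prime2 // eq_sym.
Qed.

Lemma free_decomposition (s : seq nat) : uniq s -> all prime s ->
  all (dvdn^~ #|F|.-1) s ->
  exists2 h, span (\prod_(r <- s) r)%N ((2 ^ size s)%:R - 1) h &
    forall x, (free s x)%:R = theta s * (eps x + h x).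
Proof.
elim: s => [_ _ _|p s IH] /=.
  exists (fun=> 0); first by rewrite expn0 subrr; apply: span0.
  by move=> x; rewrite /free /theta big_nil andbT addr0 mul1r.
case/andP=> ps us /andP[pp aps] /andP[pn an].
have [h sh free_h] := IH us aps an.
have cop := coprime_prod_primes aps pp ps.
have [h' sh' power_h'] := power_decomposition cop pp pn sh free_h.
exists (fun x => h x + -1 * h' x).
  have -> : (2 ^ (size s).+1)%:R - 1 =
    ((2 ^ size s)%:R - 1) + `|-1| * (1 + ((2 ^ size s)%:R - 1)) :> algC.
    by rewrite normrN1 expnS natrM; ring.
  rewrite big_cons mulnC; apply: spanD; last exact: spanZ.
  by apply: span_dvdn sh; rewrite dvdn_mulr.
move=> x; have -> : free (p :: s) x = free s x && ~~ power p x.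
  by rewrite /free /= andbA andbAC -!andbA.
have := power_h' x; have := free_h x.
rewrite /theta big_cons -/(theta s).
have -> : (free s x && ~~ power p x)%:R =
   (free s x)%:R - (free s x && power p x)%:R :> algC.
  by case: (free s x); case: (power p x); rewrite /= ?subrr ?subr0.
by move=> fh ->; rewrite fh; ring.
Qed.

(** * Correlations along the line [(x, a - c x)] *)

Definition corr a c (f g : F -> algC) : algC :=
  \sum_(x : F) f x * g (a - c * x).

(** Taking [y = a - c x] as the new variable exchanges the two entries, so an estimate for one side
    yields the one for the other. *)
Lemma corrC a c f g : c != 0 -> corr a c f g = corr (a / c) c^-1 g f.
Proof.
move=> c0; rewrite /corr (reindex_inj (h := fun y => a / c - c^-1 * y)) /=.
  apply: eq_bigr => y _; rewrite mulrC; congr (g _ * _); by field.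
move=> x y /(addrI (a / c))/oppr_inj/mulfI; apply; by rewrite invr_eq0.
Qed.

(** The map [u] serves as the identity or as [x |-> a - c x], so that either factor of a correlation
    can be expanded in characters. *)
Lemma span_sum_le m w f (u : F -> F) (phi : F -> algC) B :
  (forall chi, exponent_char m chi ->
     `|\sum_(x : F) chi (u x) * phi x| <= B) ->
  span m w f -> `|\sum_(x : F) f (u x) * phi x| <= w * B.
Proof.
move=> chiB; elim=> {w f}.
- by move=> chi /chiB; rewrite mul1r.
- by rewrite big1 ?normr0 ?mul0r // => x _; rewrite mul0r.
- move=> w v f g _ sf _ sg; under eq_bigr do rewrite mulrDl.
  rewrite big_split mulrDl; apply: le_trans (ler_normD _ _) _; exact: lerD.
- move=> b w f _ sf; under eq_bigr do rewrite -mulrA.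
  by rewrite -mulr_sumr normrM -mulrA ler_wpM2l.
by move=> w f g fg _; under eq_bigr do rewrite fg.
Qed.

Lemma corr_span m m' w v f g a c : a != 0 -> c != 0 ->
  span m w f -> span m' v g ->
  `|corr a c f g| <= w * (v * sqrtC #|F|%:R).
Proof.
move=> a0 c0 sf sg; apply: (span_sum_le (u := id)) sf => chi [mc nc _].
rewrite (eq_bigr (fun x => g (a - c * x) * chi x)); last by move=> x _; rewrite mulrC.
apply: (span_sum_le (u := fun x => a - c * x)) sg => psi [mp np _].
rewrite (eq_bigr (fun x => chi x * psi (a - c * x))).
  exact: linear_Jacobi_sum_le.
by move=> x _; rewrite mulrC.
Qed.

Lemma corr_eps_span m w f a c : a != 0 -> c != 0 -> span m w f ->
  `|corr a c eps f| <= w.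
Proof.
move=> a0 c0 sf; rewrite /corr.
rewrite (eq_bigr (fun x => f (a - c * x) * eps x)); last by move=> x _; rewrite mulrC.
rewrite -[w]mulr1; apply: (span_sum_le (u := fun x => a - c * x)) sf.
move=> psi [mp np _]; have := trivial_Jacobi_sum_le mp np a0 c0.
rewrite big_mkcond /=; congr (`|_| <= _); apply: eq_bigr => x _.
by rewrite /eps; case: eqP => _; rewrite ?mulr0 ?mulr1.
Qed.

Lemma corr_span_eps m w f a c : a != 0 -> c != 0 -> span m w f ->
  `|corr a c f eps| <= w.
Proof.
move=> a0 c0 sf; rewrite corrC //.
by apply: corr_eps_span sf; rewrite ?mulf_neq0 ?invr_eq0.
Qed.

Lemma corr_eps_eps a c : a != 0 -> c != 0 ->
  corr a c eps eps = #|F|%:R - 2%:R.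
Proof.
move=> a0 c0; have ac0 : a / c != 0 by rewrite mulf_neq0 ?invr_eq0.
have <- : \sum_(z : F) 1 = #|F|%:R :> algC by rewrite sumr_const.
rewrite /corr [X in X - _](bigD1 0) //= [X in _ + X - _](bigD1 (a / c)) //=.
rewrite (bigD1 0) //= {1}/eps eqxx mul0r add0r.
rewrite (bigD1 (a / c)) //= {2}/eps mulrCA divff // mulr1 subrr eqxx mulr0 add0r.
rewrite (eq_bigr (fun=> 1)); last first.
  move=> x /andP[x0 xac]; rewrite /eps x0 mul1r subr_eq0.
  suff -> : a != c * x by [].
  by apply: contra xac => /eqP->; rewrite mulrC mulKf.
ring.
Qed.

Lemma corrDl a c f g k :
  corr a c (fun x => f x + g x) k = corr a c f k + corr a c g k.
Proof. by rewrite /corr -big_split; apply: eq_bigr => x _; rewrite mulrDl. Qed.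

Lemma corrDr a c f g k :
  corr a c k (fun x => f x + g x) = corr a c k f + corr a c k g.
Proof. by rewrite /corr -big_split; apply: eq_bigr => x _; rewrite mulrDr. Qed.

Lemma corrZl a c b f g : corr a c (fun x => b * f x) g = b * corr a c f g.
Proof. by rewrite /corr mulr_sumr; apply: eq_bigr => x _; rewrite mulrA. Qed.

Lemma corrZr a c b f g : corr a c f (fun x => b * g x) = b * corr a c f g.
Proof. by rewrite /corr mulr_sumr; apply: eq_bigr => x _; rewrite mulrCA. Qed.

Lemma eq_corr a c f f' g g' : f =1 f' -> g =1 g' ->
  corr a c f g = corr a c f' g'.
Proof. by move=> ff gg; apply: eq_bigr => x _; rewrite ff gg. Qed.

Definition indicator (P : pred F) x : algC := (P x)%:R.

Lemma corr_indicator_ge0 a c P Q : 0 <= corr a c (indicator P) (indicator Q).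
Proof. by apply: sumr_ge0 => x _; rewrite mulr_ge0 ?ler0n. Qed.

Lemma theta_gt0 (s : seq nat) : all prime s -> 0 < theta s.
Proof.
move=> ps; rewrite /theta big_seq; apply: prodr_gt0 => p /(allP ps) pp.
by rewrite subr_gt0 invf_lt1 ?ltr1n ?prime_gt1 // ltr0n prime_gt0.
Qed.

(** * Estimates for the numbers of free pairs *)

Section FreeCounts.

Variable s : seq nat.
Hypotheses (us : uniq s) (ps : all prime s) (ns : all (dvdn^~ #|F|.-1) s).
Let t : algC := sqrtC #|F|%:R.
Let w : algC := (2 ^ size s)%:R.

(** Expanding both indicators, the two trivial parts give [#|F| - 2], each mixed term is at most
    [w - 1], and the product of the non-trivial parts is at most [(w - 1) ^+ 2 * t]. *)
Lemma corr_free_ge a c : a != 0 -> c != 0 ->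
  theta s ^+ 2 * (#|F|%:R - 2%:R * w - (w - 1) ^+ 2 * t) <=
  corr a c (indicator (free s)) (indicator (free s)).
Proof.
move=> a0 c0; have th0 := theta_gt0 ps.
have [h sh free_h] := free_decomposition us ps ns.
set N := corr _ _ _ _.
have NE : N = theta s ^+ 2 * ((#|F|%:R - 2%:R) +
    (corr a c eps h + corr a c h eps + corr a c h h)).
  rewrite /N (eq_corr a c free_h free_h) corrZl corrZr.
  by rewrite corrDl !corrDr corr_eps_eps //; ring.
have : theta s ^+ 2 * (#|F|%:R - 2%:R) - N <=
    theta s ^+ 2 * ((w - 1) + (w - 1) + (w - 1) * ((w - 1) * t)).
  apply: le_trans (real_ler_norm _) _.
    rewrite rpredB ?rpredM ?rpredX ?rpredB ?realn ?(gtr0_real th0) //.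
    exact/ger0_real/corr_indicator_ge0.
  move: NE; move: (_ - 2%:R) => Q ->.
  rewrite mulrDr opprD addrA subrr add0r normrN normrM.
  rewrite normrX (gtr0_norm th0) ler_wpM2l ?exprn_ge0 ?(ltW th0) //.
  apply: le_trans (ler_normD _ _) _; apply: lerD; last exact: (corr_span a0 c0 sh sh).
  apply: le_trans (ler_normD _ _) _; apply: lerD.
    exact: (corr_eps_span a0 c0 sh).
  exact: (corr_span_eps a0 c0 sh).
rewrite lerBlDl -lerBlDr => /(le_trans _); apply; rewrite -mulrBr.
by rewrite le_eqVlt; apply/orP; left; apply/eqP; ring.
Qed.

(** After [p^-1] times the free count is split off, [h'] of weight [w] is paired with [eps + h]: the
    part [eps] costs [w], and [h] costs [w * (w - 1) * t]. *)
Lemma corr_power_free_le a c p : a != 0 -> c != 0 ->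
  prime p -> (p %| #|F|.-1)%N -> p \notin s ->
  corr a c (indicator (fun x => free s x && power p x)) (indicator (free s)) <=
  p%:R^-1 * corr a c (indicator (free s)) (indicator (free s)) +
  (1 - p%:R^-1) * (theta s ^+ 2 * (w * (w - 1) * t + w)).
Proof.
move=> a0 c0 pp pn pns; have th0 := theta_gt0 ps.
have thp0 : 0 < 1 - p%:R^-1 :> algC.
  by rewrite subr_gt0 invf_lt1 ?ltr1n ?prime_gt1 // ltr0n prime_gt0.
have [h sh free_h] := free_decomposition us ps ns.
have cop := coprime_prod_primes ps pp pns.
have [h'] := power_decomposition cop pp pn sh free_h.
rewrite addrC subrK -/w => sh' power_h'.
rewrite -lerBlDl; apply: le_trans (real_ler_norm _) _.
  rewrite rpredB ?rpredM ?rpredV ?realn //.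
    exact/ger0_real/corr_indicator_ge0.
  exact/ger0_real/corr_indicator_ge0.
rewrite (eq_corr a c power_h' (fun=> erefl)) corrDl !corrZl addrC addKr.
rewrite (eq_corr a c (fun=> erefl) free_h) corrZr corrDr.
rewrite 3!normrM (gtr0_norm th0) (gtr0_norm thp0) -!mulrA.
rewrite ler_wpM2l ?(ltW thp0) // !ler_wpM2l ?(ltW th0) //.
apply: le_trans (ler_normD _ _) _; rewrite [leRHS]addrC.
apply: lerD; first exact: (corr_span_eps a0 c0 sh').
exact: (corr_span a0 c0 sh' sh).
Qed.

Lemma corr_free_power_le a c p : a != 0 -> c != 0 ->
  prime p -> (p %| #|F|.-1)%N -> p \notin s ->
  corr a c (indicator (free s)) (indicator (fun x => free s x && power p x)) <=
  p%:R^-1 * corr a c (indicator (free s)) (indicator (free s)) +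
  (1 - p%:R^-1) * (theta s ^+ 2 * (w * (w - 1) * t + w)).
Proof.
move=> a0 c0 pp pn pns; rewrite ![corr a c _ _]corrC //.
by apply: corr_power_free_le; rewrite ?mulf_neq0 ?invr_eq0.
Qed.

End FreeCounts.

(** * The sieve and its positivity criterion *)

Lemma all_union_bound (P : pred nat) (r : seq nat) :
  1 - \sum_(p <- r) (P p)%:R <= (all (fun p => ~~ P p) r)%:R :> algC.
Proof.
elim: r => [|p r IH]; first by rewrite big_nil subr0.
rewrite big_cons /=; case: (P p) => /=; last by rewrite add0r.
by rewrite opprD addrA subrr sub0r oppr_le0 sumr_ge0 // => k _; rewrite ler0n.
Qed.

(** The inequality holds term by term. Where both entries are free of [s], the left side is 1 minus
    the number of pairs of a prime of [r] and an entry that is a power for it. *)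
Lemma sieve_ineq (s r : seq nat) a c :
  corr a c (indicator (free s)) (indicator (free s)) -
  \sum_(p <- r)
    (corr a c (indicator (fun x => free s x && power p x)) (indicator (free s)) +
     corr a c (indicator (free s)) (indicator (fun x => free s x && power p x)))
  <= corr a c (indicator (free (s ++ r))) (indicator (free (s ++ r))).
Proof.
rewrite /corr; under [X in _ - X]eq_bigr do rewrite -big_split.
rewrite [X in _ - X]exchange_big -sumrB; apply: ler_sum => x _ /=.
set y := a - c * x; rewrite /indicator.
have freeE z : free (s ++ r) z = free s z && all (fun p => ~~ power p z) r.
  by rewrite /free all_cat andbA.
rewrite !freeE; case: (free s x); last first.
  by rewrite !mul0r sub0r big1 ?oppr0 // => p _; rewrite !mul0r addr0.
case: (free s y); last first.
  by rewrite !mulr0 sub0r big1 ?oppr0 // => p _; rewrite !mulr0 addr0.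
rewrite /= mul1r; under [X in _ - X]eq_bigr do rewrite mulr1 mul1r.
rewrite big_split /=; have := all_union_bound (power^~ x) r.
have := all_union_bound (power^~ y) r.
set Sx := \sum_(p <- r) (power p x)%:R; set Sy := \sum_(p <- r) (power p y)%:R.
have Sx0 : 0 <= Sx by rewrite sumr_ge0 // => k _; rewrite ler0n.
have Sy0 : 0 <= Sy by rewrite sumr_ge0 // => k _; rewrite ler0n.
rewrite opprD addrA.
(* If an entry fails, the union bound makes its own sum at least 1, and the left side is already at
   most 0. *)
case: all => Hy; case: all => Hx; rewrite ?mulr1 ?mul1r ?mulr0.
- by rewrite -addrA -opprD gerBl addr_ge0.
- by rewrite lerBlDr add0r; apply: le_trans Hx _.
- rewrite addrAC; apply: le_trans Hy; by rewrite gerBl.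
by apply: le_trans Hx; rewrite gerBl.
Qed.

(** If the order of [x] were a proper divisor of [#|F|.-1], any prime [p] dividing the quotient
    would make [x] a [p]-th power. *)
Lemma free_primitive_root x : free (primes #|F|.-1) x -> primitive_root x.
Proof.
case/andP=> x0 /allP notpow; have ux : x \is a GRing.unit by rewrite unitfE.
pose u : {unit F} := FinRing.unit F ux; exists u => //.
rewrite /generator eq_sym eqEcard subsetT card_finField_unit -orderE.
have n0 := card_field_pred_gt0.
have du : (#[u]%g %| #|F|.-1)%N by rewrite -card_finField_unit order_dvdG ?inE.
rewrite leqNgt; apply/negP=> lt_u.
have q1 : (1 < #|F|.-1 %/ #[u]%g)%N by rewrite ltn_divRL // mul1n.
set p := pdiv (#|F|.-1 %/ #[u]%g).
have pdv : (p %| #|F|.-1 %/ #[u]%g)%N by apply: pdiv_dvd.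
have pn : (p * #[u]%g %| #|F|.-1)%N by rewrite -(divnK du) dvdn_mul.
have pn' : (p %| #|F|.-1)%N by apply: dvdn_trans pn; rewrite dvdn_mulr.
have pp : prime p by apply: pdiv_prime.
have := notpow p; rewrite mem_primes pp n0 pn' => /(_ isT)/negP[].
have : (#[u]%g %| #|F|.-1 %/ p)%N by rewrite dvdn_divRL // mulnC.
rewrite order_dvdn => /eqP/(congr1 (@FinRing.uval F)).
by rewrite FinRing.val_unitX /power => ->.
Qed.

(* [M / d] is the constant [(2 s - 1) / delta + 2] of the theorem. *)
Lemma criterion_gt0 (t w d M : algC) :
  2%:R <= t -> 1 <= w -> 0 < d -> d <= M -> M * w ^+ 2 < d * t ->
  0 < d * (t ^+ 2 - 2%:R * w - (w - 1) ^+ 2 * t)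
      - (M - d) * (w * (w - 1) * t + w).
Proof.
move=> t2 w1 d0 dM lt_t.
have t0 : 0 < t by apply: lt_le_trans t2; rewrite ltr0n.
have w0 : 0 < w by apply: lt_le_trans w1.
have M0 : 0 < M by apply: lt_le_trans dM.
(* This grouping isolates the hypothesis in a strictly positive first term; the others are
   non-negative by [2 <= t], [1 <= w] and [d <= M]. *)
have -> : d * (t ^+ 2 - 2%:R * w - (w - 1) ^+ 2 * t)
      - (M - d) * (w * (w - 1) * t + w) =
  t * (d * t - M * w ^+ 2) + ((t - 2%:R) * (M * w + d * (w - 1)) +
    ((M - d) * w + 2%:R * d * (w - 1))) by ring.
rewrite ltr_wpDr ?mulr_gt0 ?subr_gt0 //.
by rewrite !addr_ge0 ?mulr_ge0 ?subr_ge0 ?addr_ge0 ?mulr_ge0 ?subr_ge0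
  ?(ltW w0) ?(ltW M0) ?(ltW d0) ?ler0n.
Qed.

Section SieveCriterion.

Variables s r : seq nat.
Hypotheses (usr : uniq (s ++ r)) (psr : all prime (s ++ r)).
Hypothesis (nsr : all (dvdn^~ #|F|.-1) (s ++ r)).
Let t : algC := sqrtC #|F|%:R.
Let w : algC := (2 ^ size s)%:R.
Let d : algC := 1 - 2%:R * \sum_(p <- r) p%:R^-1.
Let M : algC := 2%:R * (size r)%:R - 1 + 2%:R * d.

(** An empty [r] is covered: then [d = M = 1] and the sieve has no error term. *)
Lemma exists_free_pair a c : a != 0 -> c != 0 -> (4 <= #|F|)%N ->
  0 < d -> M * w ^+ 2 < d * t ->
  exists x, free (s ++ r) x && free (s ++ r) (a - c * x).
Proof.
move=> a0 c0 q4 d0 lt_t.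
move: usr psr nsr; rewrite cat_uniq !all_cat.
case/and3P=> us /hasPn dsr ur /andP[ps pr] /andP[ns nr].
have th0 : 0 < theta s ^+ 2 by rewrite exprn_gt0 ?theta_gt0.
have tt : t ^+ 2 = #|F|%:R by rewrite sqrtCK.
(* Each prime of [r] contributes the error factor [1 - p^-1] once for each of the two entries;
   [M - d] is their total. *)
have MdE : M - d = \sum_(p <- r) 2%:R * (1 - p%:R^-1).
  rewrite -mulr_sumr sumrB /M /d big_const_seq count_predT iter_addr addr0.
  ring.
have dM : d <= M.
  rewrite -subr_ge0 MdE big_seq sumr_ge0 // => p /(allP pr) pp.
  rewrite mulr_ge0 ?ler0n // subr_ge0 invf_le1 ?ler1n ?ltr0n prime_gt0 //.
have t2 : 2%:R <= t.
  rewrite -(ler_pXn2r (n := 2)) ?nnegrE ?sqrtC_ge0 ?ler0n // tt -natrX ler_nat.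
  exact: q4.
have w1 : 1 <= w by rewrite ler1n expn_gt0.
set S := w * (w - 1) * t + w.
pose N0 := corr a c (indicator (free s)) (indicator (free s)).
have N_gt0 : 0 < corr a c (indicator (free (s ++ r))) (indicator (free (s ++ r))).
  apply: lt_le_trans (sieve_ineq s r a c).
  have : theta s ^+ 2 * (d * (t ^+ 2 - 2%:R * w - (w - 1) ^+ 2 * t) - (M - d) * S)
     <= d * N0 - (M - d) * (theta s ^+ 2 * S).
    rewrite mulrBr [_ * (d * _)]mulrCA [_ * (_ * S)]mulrCA lerD2r.
    by rewrite ler_pM2l // tt; apply: corr_free_ge.
  move/(lt_le_trans _); move=> /(_ 0); rewrite mulr_gt0 ?criterion_gt0 //.
  move=> /(_ isT) /lt_le_trans; apply.
  (* The main terms [p^-1 * N0], subtracted twice for each prime, turn [N0] into [d * N0]. *)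
  have -> : d * N0 - (M - d) * (theta s ^+ 2 * S) = N0 - \sum_(p <- r)
     2%:R * (p%:R^-1 * N0 + (1 - p%:R^-1) * (theta s ^+ 2 * S)).
    rewrite -mulr_sumr big_split /= -!mulr_suml MdE -mulr_sumr /d; ring.
  rewrite lerB // big_seq [leRHS]big_seq; apply: ler_sum => p rp.
  have pp := allP pr _ rp; have pn := allP nr _ rp; have ps' := dsr _ rp.
  rewrite -[2%:R]/(1 + 1) mulrDl mul1r lerD //.
    exact: corr_power_free_le.
  exact: corr_free_power_le.
apply/existsP; apply: contraTT N_gt0 => /existsPn none.
rewrite /corr big1 ?ltxx // => x _; rewrite /indicator -natrM mulnb.
by rewrite (negPf (none x)).
Qed.

End SieveCriterion.

End MultiplicativeCharacters.

(** * Sieving primes and the conclusion *)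

Lemma Rad_primes_sub m n : (0 < m)%N -> Rad m = Rad n ->
  {subset primes n <= primes m}.
Proof.
move=> m0 eqR p pn; have pp : prime p by move: pn; rewrite mem_primes => /andP[].
have : (p %| Rad m)%N by rewrite eqR /Rad (big_rem p) //= dvdn_mulr.
rewrite /Rad Euclid_dvd_prod // big_has => /hasP[k km].
have : prime k by move: km; rewrite mem_primes => /andP[].
by move=> pk; rewrite dvdn_prime2 // => /eqP->.
Qed.

(** With an empty list the general formulas return the prescribed values 0 and 1, so the two cases
    in the definitions of [sieve_s] and [sieve_delta] merge. *)
Lemma sieving_primes_Rad q e : (0 < e)%N -> Rad e = Rad q.-1 ->
  sieving_primes q e = [::].
Proof.
move=> e0 /(Rad_primes_sub e0) sub; apply/eqP; rewrite -size_eq0 size_filter.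
rewrite -leqn0 leqNgt -has_count -all_predC; apply/allP => p /sub.
by rewrite mem_primes /= => /and3P[_ _ ->].
Qed.

Lemma sieve_sE q e : (0 < e)%N -> sieve_s q e = size (sieving_primes q e).
Proof.
by move=> e0; rewrite /sieve_s; case: eqP => // /(sieving_primes_Rad e0) ->.
Qed.

Lemma sieve_deltaE q e : (0 < e)%N ->
  sieve_delta q e = 1 - 2%:R * \sum_(p <- sieving_primes q e) (p%:R)^-1.
Proof.
move=> e0; rewrite /sieve_delta; case: eqP => // /(sieving_primes_Rad e0) ->.
by rewrite big_nil mulr0 subr0.
Qed.

Lemma primes_sieving q e : (0 < q.-1)%N -> (e %| q.-1)%N ->
  perm_eq (primes e ++ sieving_primes q e) (primes q.-1).
Proof.
move=> q0 eq; have e0 := dvdn_gt0 q0 eq.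
rewrite perm_sym -(perm_filterC (fun p => p %| e)%N) perm_cat //.
apply: uniq_perm; rewrite ?filter_uniq ?primes_uniq // => p.
rewrite mem_filter !mem_primes q0 e0 /=; case: (prime p) => /=; rewrite ?andbF //.
by apply/andP/idP => [[]//|pe]; rewrite pe (dvdn_trans pe eq).
Qed.

Theorem theorem2 (q e : nat)
  (hq : prime_power q) (hq4 : (4 <= q)%N)
  (he0 : (0 < e)%N) (he : (e %| q.-1)%N)
  (hdelta : 0 < sieve_delta q e)
  (hbound : ((2%:R * (sieve_s q e)%:R - 1) / sieve_delta q e + 2%:R) ^+ 2
              * (W e)%:R ^+ 4 < q%:R :> rat) :
  in_G q.
Proof.
split=> // F cF a c a0 c0; rewrite -cF in hq4 he hdelta hbound.
set s := primes e; set r := sieving_primes #|F| e.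
have n0 := card_field_pred_gt0 F.
have psr := primes_sieving n0 he.
have usr : uniq (s ++ r) by rewrite (perm_uniq psr) primes_uniq.
have prsr : all prime (s ++ r).
  by apply/allP=> p; rewrite (perm_mem psr) mem_primes => /andP[].
have dsr : all (dvdn^~ #|F|.-1) (s ++ r).
  by apply/allP=> p; rewrite (perm_mem psr) mem_primes => /and3P[].
move: hdelta hbound; rewrite sieve_sE // sieve_deltaE // -/r.
set D := 1 - _ => D0 hb.
pose d : algC := 1 - 2%:R * \sum_(p <- r) p%:R^-1.
have dE : ratr D = d.
  rewrite /D rmorphB rmorphM /= rmorph1 rmorph_nat rmorph_sum /=.
  by congr (1 - _ * _); apply: eq_bigr => p _; rewrite fmorphV rmorph_nat.
have d0 : 0 < d by rewrite -dE ltr0q.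
(* This is the square root of the hypothesis, cleared of the denominator [d] and moved from [rat] to
   [algC]. *)
have hb' : (2%:R * (size r)%:R - 1 + 2%:R * d) * (2 ^ size s)%:R ^+ 2 <
    d * sqrtC #|F|%:R.
  move: hb; rewrite -(ltr_rat algC) rmorphM rmorphXn rmorphD fmorph_div /=.
  rewrite rmorphB rmorphM rmorphXn /= rmorph1 !rmorph_nat dE => hb.
  have t0 : 0 <= sqrtC #|F|%:R :> algC by rewrite sqrtC_ge0 ler0n.
  have Mreal : (2%:R * (size r)%:R - 1 + 2%:R * d) * (2 ^ size s)%:R ^+ 2
      \is Num.real.
    by rewrite rpredM ?rpredX ?rpredD ?rpredN ?rpredM ?rpred1 ?realn
         ?(gtr0_real d0).
  have dt0 : 0 <= d * sqrtC #|F|%:R by rewrite mulr_ge0 ?(ltW d0).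
  rewrite (real_ltNge Mreal (ger0_real dt0)).
  (* The reverse inequality makes both sides non-negative, so it can be squared; this contradicts
     the hypothesis multiplied by [d ^+ 2]. *)
  apply/negP=> le_dM; move: hb; apply/negP; rewrite le_gtF //.
  have := lerXn2r 2 dt0 (le_trans dt0 le_dM) le_dM.
  rewrite exprMn sqrtCK => /le_trans le_sq; rewrite -(ler_pM2l (exprn_gt0 2 d0)).
  apply: le_sq.
  rewrite le_eqVlt; apply/orP; left; apply/eqP; rewrite /W /omega -/s.
  by field; rewrite gt_eqF.
have [x] := exists_free_pair usr prsr dsr a0 c0 hq4 d0 hb'.
rewrite /free !(perm_all _ psr) => /andP[fx fy].
by exists x; split; apply: free_primitive_root.
Qed.
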